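(* There is an absolute constant $C$ such that the following holds. Let $X=(x_1,\dots,x_n)$ be an $n\times n$ real matrix with $s$-sparse column vectors $x_1,\dots,x_n$, and let $r$ be the cardinality of the set $\{j:|x_j|_1=\max_k|x_k|_1\}$. Then $$w^2\big(D(|||\cdot|||_1,X)\big)\le1+n^2-r\big(n-s\log(Cn^4r^2)\big).$$ In particular, when $r=n$, $$w^2\big(D(|||\cdot|||_1,X)\big)\le1+ns\log(Cn^6).$$
   Context: For $Z=(z_1,\dots,z_n)\in\mathbb{R}^{n\times n}$ with columns $z_j$, $|||Z|||_1:=\max_j|z_j|_1$ ($|\cdot|_1$ the vector $l_1$-norm). A vector is $s$-sparse if it has at most $s$ nonzero components. For a proper convex function $F$, $D(F,X):=\{V:F(X+tV)\le F(X)\text{ for some }t>0\}$. For a cone $K\subseteq\mathbb{R}^{n\times n}$, the conic Gaussian width is $w(K):=E_G[\sup\{\langle G,U\rangle:U\in K,\ |U|_F=1\}]$, where $G$ is an $n\times n$ random matrix with i.i.d. $N(0,1)$ entries, $\langle G,U\rangle=\mathrm{tr}(G^TU)$ and $|\cdot|_F$ is the Frobenius norm. *)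

(* Defs.v *)
From HB Require Import structures.
From mathcomp Require Import all_boot all_order all_algebra.
From mathcomp Require Import all_classical all_reals all_analysis.

Set Implicit Arguments.
Unset Strict Implicit.
Unset Printing Implicit Defensive.

Import Order.TTheory GRing.Theory Num.Theory.
Import numFieldNormedType.Exports.

Local Open Scope classical_set_scope.
Local Open Scope ring_scope.

Definition l1norm (R : realType) (n : nat) (v : 'cV[R]_n) : R :=
  \sum_(i < n) `|v i 0|.

Definition sparse (R : realType) (n s : nat) (v : 'cV[R]_n) : Prop :=
  (#|[pred i : 'I_n | (v i 0 != 0)%R]| <= s)%N.

(* The base value 0 of the maximum is harmless for n > 0, as norms are >= 0. *)
Definition max_l1norm (R : realType) (n : nat) (Z : 'M[R]_n) : R :=
  \big[Num.max/0]_(j < n) l1norm (col j Z).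

Definition max_l1_columns (R : realType) (n : nat) (X : 'M[R]_n) : {set 'I_n} :=
  [set j | l1norm (col j X) == max_l1norm X]%SET.

Definition descent_cone (R : realType) (n : nat) (F : 'M[R]_n -> R)
    (X : 'M[R]_n) : set 'M[R]_n :=
  [set V | exists t : R, 0 < t /\ F (X + t *: V) <= F X].

Definition frobenius (R : realType) (n : nat) (U : 'M[R]_n) : R :=
  Num.sqrt (\sum_(i < n) \sum_(j < n) U i j ^+ 2).

Definition frobenius_sphere (R : realType) (n : nat) : set 'M[R]_n :=
  [set U | frobenius U = 1].

Definition mutually_independent (d : measure_display) (T : measurableType d)
    (R : realType) (P : probability T R) (I : finType)
    (Y : I -> {RV P >-> R}) : Prop :=
  forall (J : {set I}) (A : I -> set R), (forall i, measurable (A i)) ->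
    P (\bigcap_(i in [set` J]) (Y i @^-1` A i)) =
    (\prod_(i in J) P (Y i @^-1` A i))%E.

Definition iid_standard_gaussian (d : measure_display) (T : measurableType d)
    (R : realType) (P : probability T R) (n : nat)
    (G : 'I_n -> 'I_n -> {RV P >-> R}) : Prop :=
  mutually_independent (fun ij : 'I_n * 'I_n => G ij.1 ij.2) /\
  forall (i j : 'I_n) (A : set R), measurable A ->
    distribution P (G i j) A = normal_prob 0 1 A.

Definition random_matrix (d : measure_display) (T : measurableType d)
    (R : realType) (P : probability T R) (n : nat)
    (G : 'I_n -> 'I_n -> {RV P >-> R}) (w : T) : 'M[R]_n :=
  \matrix_(i, j) G i j w.

(* The set under the supremum is always bounded (by the Frobenius norm of the
   matrix), so the real-valued [sup] is the supremum as soon as K contains a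
   nonzero matrix; for K = {0}, where the set is empty, [sup] is 0. *)
Definition gaussian_width (d : measure_display) (T : measurableType d)
    (R : realType) (P : probability T R) (n : nat)
    (G : 'I_n -> 'I_n -> {RV P >-> R}) (K : set 'M[R]_n) : \bar R :=
  'E_P[fun w => sup [set \tr ((random_matrix G w)^T *m U) |
                       U in K `&` @frobenius_sphere R n]]%E.

(* Main.v *)
(* The width is bounded through the polar cone. If [H] has, in each column [j]
   of maximal l1-norm, [t] times a subgradient of the l1-norm at [x_j], and
   zero columns elsewhere, then [<H, U> <= 0] on the descent cone, so
   [w <= E |G - H|] and [w^2 <= E |G - H|^2]. The matrix [H] depends on [G]: on
   the support of [x_j] it is [t] times the sign, as it must be, and off the
   support it is [G] clamped to [[-t, t]]. Hence
   [E |G - H|^2 <= n(n - r) + r(s(1 + t^2) + n e(t))], where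
   [e(t) = E (|g| - t)_+^2 <= 2 exp(-t^2/2)]; take [t^2 = 2 ln(e n r)] and
   [C = e^3]. Only the marginals of [G] matter, and all Gaussian moments are
   bounded by means of [E exp(l g) = exp(l^2/2)]. *)
From HB Require Import structures.
Require Import Defs.
From mathcomp Require Import all_boot all_order all_algebra.
From mathcomp Require Import all_classical all_reals all_analysis.
From mathcomp Require Import measurable_realfun ring lra.

Set Implicit Arguments.
Unset Strict Implicit.
Unset Printing Implicit Defensive.

Import Order.TTheory GRing.Theory Num.Theory.
Import numFieldNormedType.Exports.

Local Open Scope classical_set_scope.
Local Open Scope ring_scope.

(** * Exponential moments of the standard Gaussian *)

Lemma ge0_integral_normal_prob (R : realType) (m s : R) (f : R -> \bar R) :
  measurable_fun setT f -> (forall x, 0 <= f x)%E ->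
  (\int[normal_prob m s]_x f x =
   \int[lebesgue_measure]_x (f x * (normal_pdf m s x)%:E))%E.
Proof.
move=> mf f0; have dom := normal_prob_dominates m s.
rewrite -(Radon_Nikodym_SigmaFinite.change_of_variables dom)//.
have iRN := Radon_Nikodym_SigmaFinite.f_integrable dom.
have mpdf : measurable_fun setT (EFin \o @normal_pdf R m s).
  by apply/measurable_EFinP; exact: measurable_normal_pdf.
apply: ae_eq_integral => //.
- by apply: emeasurable_funM => //; exact: measurable_int iRN.
- exact: emeasurable_funM.
(* The Radon-Nikodym derivative and the density have the same integral over every measurable set, so
   they agree almost everywhere. *)
- apply: ae_eqe_mul2l; apply: integral_ae_eq => // E _ mE.
  by rewrite -Radon_Nikodym_SigmaFinite.f_integral.
Qed.

Lemma measurable_expRMl (R : realType) (l : R) :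
  measurable_fun [set: R] (fun x => expR (l * x)).
Proof. exact: measurableT_comp. Qed.

Lemma integral_normal_expR (R : realType) (l : R) :
  (\int[normal_prob 0 1]_x (expR (l * x))%:E = (expR (l ^+ 2 / 2))%:E)%E.
Proof.
rewrite ge0_integral_normal_prob//; last first.
  by apply/measurable_EFinP; exact: measurable_expRMl.
(* Completing the square: tilting the standard density by [expR (l * x)] recentres it at [l], up to
   the factor [expR (l ^+ 2 / 2)]. *)
transitivity (\int[lebesgue_measure]_x
    ((expR (l ^+ 2 / 2))%:E * (normal_pdf l 1 x)%:E))%E.
  apply: eq_integral => x _; rewrite -!EFinM; congr EFin.
  rewrite !normal_pdfE ?oner_neq0// mulrCA [RHS]mulrCA; congr (_ * _).
  by rewrite /normal_fun -!expRD; congr expR; field.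
rewrite ge0_integralZl//.
- by rewrite integral_normal_pdf mule1.
- by apply/measurable_EFinP; exact: measurable_normal_pdf.
- by move=> x _; rewrite lee_fin normal_pdf_ge0.
Qed.

Lemma measurable_expR_sum (R : realType) (s : seq (R * R)) :
  measurable_fun [set: R] (fun x => \sum_(p <- s) p.1 * expR (p.2 * x)).
Proof.
apply: measurable_sum => p; apply: measurable_funM => //.
exact: measurable_expRMl.
Qed.

Lemma integral_normal_expR_sum (R : realType) (s : seq (R * R)) :
  {in s, forall p, 0 <= p.1} ->
  (\int[normal_prob 0 1]_x (\sum_(p <- s) p.1 * expR (p.2 * x))%:E =
   (\sum_(p <- s) p.1 * expR (p.2 ^+ 2 / 2))%:E)%E.
Proof.
elim: s => [_|p s ih s0].
  by under eq_integral do rewrite big_nil; rewrite integral0 big_nil.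
have p0 : 0 <= p.1 by apply: s0; rewrite mem_head.
have {}s0 : {in s, forall p, 0 <= p.1}.
  by move=> p' p's; apply: s0; rewrite inE p's orbT.
under eq_integral do rewrite big_cons EFinD.
rewrite ge0_integralD//; last 4 first.
- by move=> x _; rewrite lee_fin mulr_ge0 ?expR_ge0.
- apply/measurable_EFinP; apply: measurable_funM => //.
  exact: measurable_expRMl.
- move=> x _; rewrite lee_fin big_seq; apply: sumr_ge0 => p' /s0 p'0.
  by rewrite mulr_ge0 ?expR_ge0.
- by apply/measurable_EFinP; exact: measurable_expR_sum.
rewrite ih// big_cons EFinD; congr (_ + _)%E.
under eq_integral do rewrite EFinM.
rewrite ge0_integralZl//; last first.
  by apply/measurable_EFinP; exact: measurable_expRMl.
by rewrite integral_normal_expR.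
Qed.

(* The constant [c] allows bounding [q] by sums with negative constant terms. *)
Lemma integral_normal_le_expR_sum (R : realType) (q : R -> R) (c : R)
    (s : seq (R * R)) :
  measurable_fun [set: R] q -> (forall x, 0 <= q x) -> 0 <= c ->
  {in s, forall p, 0 <= p.1} ->
  (forall x, q x + c <= \sum_(p <- s) p.1 * expR (p.2 * x)) ->
  (\int[normal_prob 0 1]_x (q x)%:E <=
   (\sum_(p <- s) p.1 * expR (p.2 ^+ 2 / 2) - c)%:E)%E.
Proof.
move=> mq q0 c0 s0 qs; rewrite EFinB leeBrDr//.
have -> : (c%:E = \int[normal_prob 0 1]_(x in [set: R]) (cst c%:E x))%E.
  by rewrite integral_cst//= probability_setT mule1.
rewrite -ge0_integralD//; last 2 first.
- by move=> x _; rewrite lee_fin.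
- by apply/measurable_EFinP.
rewrite -integral_normal_expR_sum//; apply: ge0_le_integral => //=.
- by move=> x _; rewrite lee_fin addr_ge0.
- by apply/measurable_EFinP; apply: measurable_funD.
- by apply/measurable_EFinP; exact: measurable_expR_sum.
- by move=> x _; rewrite lee_fin.
Qed.

(** * Elementary bounds on the exponential *)

Lemma expRB_opp_ge2x (R : realType) (v : R) :
  0 <= v -> 2 * v <= expR v - expR (- v).
Proof.
rewrite le_eqVlt => /predU1P[<-|v0]; first by rewrite oppr0 subrr mulr0.
pose f : R -> R := expR - (expR \o -%R) - 2 *: @id R.
have df (x : R) : is_derive x 1 f (expR x + expR (- x) - 2).
  apply: is_derive_eq.
  by rewrite /GRing.scale/=; ring.
suff : f 0 <= f v by rewrite /f !fctE/= /GRing.scale/= oppr0; lra.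
apply: (@ger0_derive1_le_cc _ f 0 v) => //.
- move=> x _; rewrite derive1E derive_val subr_ge0.
  have e0 := expR_gt0 x.
  (* The derivative [expR x + expR (- x) - 2] equals [expR (- x) * (expR x - 1) ^+ 2]. *)
  have := mulr_ge0 (expR_ge0 (- x)) (sqr_ge0 (expR x - 1)).
  rewrite expRN (_ : _ * _ = expR x + (expR x)^-1 - 2) ?subr_ge0//.
  by field; rewrite gt_eqF.
- apply: continuous_subspaceT => x.
  exact/differentiable_continuous/derivable1_diffP.
- by rewrite in_itv/= lexx ltW.
- by rewrite in_itv/= lexx ltW.
- exact: ltW.
Qed.

(** With [y = expR (u / 2)], the right side is [2 + (y - y^-1) ^+ 2], and [y - y^-1 >= u] for
    [u >= 0] by the previous bound. *)
Lemma expRD_opp_ge2Dxx (R : realType) (u : R) :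
  2 + u ^+ 2 <= expR u + expR (- u).
Proof.
wlog u0 : u / 0 <= u => [H|].
  have [/H//|/ltW] := leP 0 u; rewrite -oppr_ge0 => /H.
  by rewrite sqrrN opprK addrC [leRHS]addrC.
have /expRB_opp_ge2x : 0 <= u / 2 by lra.
rewrite (expRN (u / 2)) mulrC divfK//.
set y := expR (u / 2) => uy; have y0 : y != 0 by rewrite gt_eqF ?expR_gt0.
have -> : expR u + expR (- u) = (y - y^-1) ^+ 2 + 2.
  by rewrite expRN {1 2}(splitr u) expRD -/y; field.
by rewrite addrC lerD2r ler_sqr ?nnegrE// (le_trans u0).
Qed.

Lemma expR_le1D_quadratic (R : realType) (y : R) : 0 <= y <= 2^-1 ->
  expR y <= 1 + y + 2 * y ^+ 2.
Proof.
move=> /andP[y0 y1].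
have : 1 - y <= expR (- y) by exact: expR_ge1Dx.
rewrite expRN => h.
have : expR y <= (1 - y)^-1.
  by rewrite -[leLHS]invrK lef_pV2 ?posrE ?invr_gt0 ?expR_gt0//; lra.
move=> /le_trans; apply; rewrite -div1r ler_pdivrMr; last by lra.
by nra.
Qed.

(** * Second moments of shifted and thresholded Gaussians *)

(** As [l] tends to 0, [(expR (l * x) + expR (- l * x) - 2) / l ^+ 2] tends to [x ^+ 2] and
    [2 / l * (expR (- (l * a) * x) - 1)] to [- (2 * a * x)], both from above. Exponential moments
    thus give the bound up to an arbitrarily small loss [e]. *)
Lemma integral_normal_sqrB (R : realType) (a : R) :
  (\int[normal_prob 0 1]_x ((x - a) ^+ 2)%:E <= (1 + a ^+ 2)%:E)%E.
Proof.
apply/lee_addgt0Pr => e e0.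
(* Chosen so that [l <= 1], [l ^+ 2 * a ^+ 2 <= 1] and [l * (1 + 2 * a ^+ 2) <= e]; the total loss
   is at most [l ^+ 2 + 2 * l * a ^+ 2]. *)
pose l := e / ((1 + e) * (1 + 2 * a ^+ 2)).
have a2 := sqr_ge0 a.
have d0 : 0 < (1 + e) * (1 + 2 * a ^+ 2) by nra.
have l0 : 0 < l by rewrite divr_gt0.
have ll0 : 0 < l ^+ 2 by rewrite exprn_gt0.
have lE : l * ((1 + e) * (1 + 2 * a ^+ 2)) = e by rewrite divfK ?gt_eqF.
have le : l * (1 + 2 * a ^+ 2) <= e by nra.
have l1 : l <= 1 by nra.
have la : l ^+ 2 * a ^+ 2 <= 1.
  have : l * (1 + 2 * a ^+ 2) <= 1 by nra.
  nra.
apply: le_trans.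
  apply: (@integral_normal_le_expR_sum R _ (2 / l ^+ 2 + 2 / l)
    [:: (l ^- 2, l); (l ^- 2, - l); (2 / l, - (l * a)); (a ^+ 2, 0)]).
  - by apply: measurable_funX; apply: measurable_funB.
  - by move=> x; exact: sqr_ge0.
  - by rewrite addr_ge0// divr_ge0// ltW.
  - by move=> p; rewrite !inE => /or4P[]/eqP->//=;
      rewrite ?invr_ge0 ?divr_ge0 // ltW.
  - move=> x; rewrite !big_cons big_nil/= mul0r expR0.
    have h1 := expRD_opp_ge2Dxx (l * x); rewrite -mulNr in h1.
    have h2 := expR_ge1Dx (- (l * a) * x).
    have h3 : x ^+ 2 + 2 / l ^+ 2 <= l ^- 2 * (expR (l * x) + expR (- l * x)).
      rewrite [leRHS]mulrC ler_pdivlMr//.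
      by rewrite mulrDl divfK ?gt_eqF// addrC -exprMn [x * l]mulrC.
    have h4 : - (2 * a * x) + 2 / l <= 2 / l * expR (- (l * a) * x).
      rewrite [leRHS]mulrAC ler_pdivlMr// mulrDl divfK ?gt_eqF//; lra.
    lra.
rewrite !big_cons big_nil/= lee_fin expr0n/= mul0r expR0 !sqrrN (exprMn _ l a).
have h1 : expR (l ^+ 2 / 2) <= 1 + l ^+ 2 / 2 + 2 * (l ^+ 2 / 2) ^+ 2.
  by apply: expR_le1D_quadratic; nra.
have h2 : expR (l ^+ 2 * a ^+ 2 / 2) <=
    1 + l ^+ 2 * a ^+ 2 / 2 + 2 * (l ^+ 2 * a ^+ 2 / 2) ^+ 2.
  by apply: expR_le1D_quadratic; nra.
have h3 : l ^- 2 * expR (l ^+ 2 / 2) <= l ^- 2 + 2^-1 + l ^+ 2 / 2.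
  by rewrite [leLHS]mulrC ler_pdivrMr // !mulrDl mulVf ?gt_eqF//; lra.
have h4 : 2 / l * expR (l ^+ 2 * a ^+ 2 / 2) <=
    2 / l + l * a ^+ 2 + l * (l ^+ 2 * a ^+ 2) * a ^+ 2.
  by rewrite [leLHS]mulrAC ler_pdivrMr// !mulrDl divfK ?gt_eqF//; lra.
have h5 : l * (l ^+ 2 * a ^+ 2) * a ^+ 2 <= l * a ^+ 2.
  by rewrite ler_wpM2r// ler_piMr// ltW.
have : l ^+ 2 <= l by nra.
lra.
Qed.

Definition soft_threshold (R : realType) (t x : R) : R :=
  x - Num.max (- t) (Num.min t x).

Lemma measurable_soft_threshold (R : realType) (t : R) :
  measurable_fun [set: R] (soft_threshold t).
Proof.
apply: measurable_funB => //; apply: measurable_maxr => //.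
exact: measurable_minr.
Qed.

(** One exponential per tail: for [y >= t], the quadratic Taylor term of [expR (t * (y - t))] is
    [t ^+ 2 * (y - t) ^+ 2 / 2], which dominates [(y - t) ^+ 2] once [t ^+ 2 >= 2]. *)
Lemma soft_threshold_sqr_le (R : realType) (t x : R) : 0 <= t -> 2 <= t ^+ 2 ->
  soft_threshold t x ^+ 2 <=
  expR (- t ^+ 2) * expR (t * x) + expR (- t ^+ 2) * expR (- t * x).
Proof.
move=> t0 t2.
have key y : t <= y -> (y - t) ^+ 2 <= expR (- t ^+ 2) * expR (t * y).
  move=> ty; rewrite -expRD.
  have -> : - t ^+ 2 + t * y = t * (y - t) by ring.
  have /(@expR_ge1Dxn _ _ 1) : 0 <= t * (y - t) by rewrite mulr_ge0// subr_ge0.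
  apply: le_trans; rewrite exprMn (_ : 2`! = 2)%N//.
  have := sqr_ge0 (y - t); nra.
have e0 y : 0 <= expR (- t ^+ 2) * expR y by rewrite mulr_ge0 ?expR_ge0.
rewrite /soft_threshold; have [tx|xt] := leP t x.
  by rewrite max_r ?(le_trans _ t0) ?oppr_le0// ler_wpDr// key.
have [tx|tx] := leP (- t) x.
  by rewrite subrr expr0n/= addr_ge0.
rewrite ler_wpDl// mulNr -mulrN -sqrrN opprB addrC key//; lra.
Qed.

Lemma integral_normal_soft_threshold (R : realType) (t : R) :
  0 <= t -> 2 <= t ^+ 2 ->
  (\int[normal_prob 0 1]_x (soft_threshold t x ^+ 2)%:E <=
   (2 * expR (- (t ^+ 2 / 2)))%:E)%E.
Proof.
move=> t0 t2; apply: le_trans.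
  apply: (@integral_normal_le_expR_sum R _ 0
    [:: (expR (- t ^+ 2), t); (expR (- t ^+ 2), - t)]) => //.
  - by apply: measurable_funX; exact: measurable_soft_threshold.
  - by move=> x; exact: sqr_ge0.
  - by move=> p; rewrite !inE => /orP[]/eqP->/=; exact: expR_ge0.
  - move=> x; rewrite !big_cons big_nil/= !addr0.
    exact: soft_threshold_sqr_le.
rewrite lee_fin !big_cons big_nil/= sqrrN addr0 subr0 -!expRD.
have -> : - t ^+ 2 + t ^+ 2 / 2 = - (t ^+ 2 / 2) by field.
lra.
Qed.

(** * Integral bounds without measurability, and integrals of Gaussian entries *)

(* Unlike [ge0_le_integral], this does not need measurability: the integral of
   a nonnegative function is a supremum over the simple functions below it. *)
Lemma ge0_le_integral_nonmeasurable (d : measure_display)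
    (T : measurableType d) (R : realType) (mu : {measure set T -> \bar R})
    (f g : T -> \bar R) :
  (forall x, 0 <= f x)%E -> (forall x, f x <= g x)%E ->
  (\int[mu]_x f x <= \int[mu]_x g x)%E.
Proof.
move=> f0 fg; have g0 x : (0 <= g x)%E := le_trans (f0 x) (fg x).
rewrite !ge0_integralTE//; apply: le_ereal_sup => _ [h hf <-].
by exists h => // x; apply: le_trans (fg x).
Qed.

(** Meant for [f] a supremum over the cone, whose measurability is not established. The positive and
    negative parts of [f] have integrals in [[0, b]], so their difference lies in [[-b, b]]. *)
Lemma sqr_integral_le_nonmeasurable (d : measure_display)
    (T : measurableType d) (R : realType) (mu : {measure set T -> \bar R})
    (f g h : T -> R) (b : R) :
  (forall x, 0 <= g x) -> (forall x, 0 <= h x) ->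
  (forall x, f x <= g x) -> (forall x, - f x <= h x) ->
  (\int[mu]_x (g x)%:E <= b%:E)%E -> (\int[mu]_x (h x)%:E <= b%:E)%E ->
  ((\int[mu]_x (f x)%:E) ^+ 2 <= (b ^+ 2)%:E)%E.
Proof.
move=> g0 h0 fg fh gb hb; rewrite integralE.
set p := (\int[mu]_x _)%E; set m := (\int[mu]_x _)%E.
have p0 : (0 <= p)%E by apply: integral_ge0.
have m0 : (0 <= m)%E by apply: integral_ge0.
have pb : (p <= b%:E)%E.
  apply: le_trans gb; apply: ge0_le_integral_nonmeasurable => // x.
  by rewrite funeposE ge_max !lee_fin fg g0.
have mb : (m <= b%:E)%E.
  apply: le_trans hb; apply: ge0_le_integral_nonmeasurable => // x.
  by rewrite funenegE ge_max -EFinN !lee_fin fh h0.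
move: p m p0 m0 pb mb => [p| |] [m| |] //; rewrite !lee_fin => p0 m0 pb mb.
have : 0 <= (b - (p - m)) * (b + (p - m)) by apply: mulr_ge0; lra.
lra.
Qed.

Lemma integral_standard_gaussian (d : measure_display) (T : measurableType d)
    (R : realType) (P : probability T R) (Y : {RV P >-> R}) (q : R -> R) :
  (forall A : set R, measurable A -> distribution P Y A = normal_prob 0 1 A) ->
  measurable_fun [set: R] q -> (forall x, 0 <= q x) ->
  (\int[P]_w (q (Y w))%:E = \int[normal_prob 0 1]_x (q x)%:E)%E.
Proof.
move=> YE mq q0.
have mY : measurable_fun [set: T] (Y : T -> measurableTypeR R).
  exact: (@measurable_funPT _ _ _ _ Y).
pose Y' : {RV P >-> measurableTypeR R} :=
  HB.pack (Y : T -> measurableTypeR R) (isMeasurableFun.Build _ _ _ _ _ mY).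
rewrite -(@ge0_integral_distribution _ _ _ _ _ _ Y' (EFin \o q))//; last first.
  by apply/measurable_EFinP.
by rewrite (eq_measure_integral (normal_prob 0 1)) => [//|A mA _]; exact: YE.
Qed.

Lemma integral_sum_standard_gaussian_le (d : measure_display)
    (T : measurableType d) (R : realType) (P : probability T R) (m n : nat)
    (G : 'I_m -> 'I_n -> {RV P >-> R}) (q : 'I_m -> 'I_n -> R -> R)
    (c : 'I_m -> 'I_n -> R) :
  (forall i j (A : set R), measurable A ->
    distribution P (G i j) A = normal_prob 0 1 A) ->
  (forall i j, measurable_fun [set: R] (q i j)) ->
  (forall i j x, 0 <= q i j x) ->
  (forall i j, \int[normal_prob 0 1]_x (q i j x)%:E <= (c i j)%:E)%E ->
  (\int[P]_w (\sum_i \sum_j q i j (G i j w))%:E <=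
   (\sum_i \sum_j c i j)%:E)%E.
Proof.
move=> GE mq q0 qc.
have mqG i j : measurable_fun [set: T] (fun w => (q i j (G i j w))%:E).
  by apply/measurable_EFinP; apply: measurableT_comp.
under eq_integral do rewrite -sumEFin.
under eq_integral => w _ do under eq_bigr do rewrite -sumEFin.
rewrite ge0_integral_sum//; last 2 first.
- by move=> i; apply: emeasurable_sum => j.
- by move=> i w _; apply: sume_ge0 => j _; rewrite lee_fin.
rewrite -sumEFin; apply: lee_sum => i _.
rewrite ge0_integral_sum//; last by move=> j w _; rewrite lee_fin.
rewrite -sumEFin; apply: lee_sum => j _.
by rewrite integral_standard_gaussian// => A; exact: GE.
Qed.

(** Integrates the AM-GM majorant of the square root of [S]; for [c = b ^+ 2] the bound is [b]. *)
Lemma integral_halfD_le (d : measure_display) (T : measurableType d)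
    (R : realType) (P : probability T R) (S : T -> R) (b c : R) :
  measurable_fun [set: T] S -> (forall w, 0 <= S w) -> 0 < b ->
  (\int[P]_w (S w)%:E <= c%:E)%E ->
  (\int[P]_w ((S w / b + b) / 2)%:E <= ((c / b + b) / 2)%:E)%E.
Proof.
move=> mS S0 b0 Sc.
have E x : (x / b + b) / 2 = (2 * b)^-1 * x + b / 2 by field; rewrite gt_eqF.
under eq_integral do rewrite E EFinD EFinM.
have k0 : 0 <= (2 * b)^-1 by rewrite invr_ge0 mulr_ge0// ltW.
rewrite ge0_integralD//; last 3 first.
- by move=> w _; rewrite -EFinM lee_fin mulr_ge0.
- by apply/measurable_EFinP; apply: measurable_funM.
- by move=> w _; rewrite lee_fin divr_ge0// ltW.
rewrite ge0_integralZl//; last 2 first.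
- by apply/measurable_EFinP.
- by move=> w _; rewrite lee_fin.
rewrite integral_cst//= probability_setT mule1.
by rewrite E EFinD leeD2r// EFinM lee_wpmul2l.
Qed.

(** * Subgradients and the descent cone of the maximal column norm *)

Lemma mxtrace_trmxM (R : comNzRingType) (m n : nat) (A B : 'M[R]_(m, n)) :
  \tr (A^T *m B) = \sum_i \sum_j A i j * B i j.
Proof.
rewrite exchange_big; apply: eq_bigr => j _; rewrite mxE.
by apply: eq_bigr => i _; rewrite mxE.
Qed.

Lemma sqr_frobenius (R : realType) (n : nat) (U : 'M[R]_n) :
  frobenius U ^+ 2 = \sum_i \sum_j U i j ^+ 2.
Proof.
rewrite sqr_sqrtr//.
by apply: sumr_ge0 => i _; apply: sumr_ge0 => j _; exact: sqr_ge0.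
Qed.

Lemma l1norm_col_le_max (R : realType) (n : nat) (Z : 'M[R]_n) (j : 'I_n) :
  l1norm (col j Z) <= max_l1norm Z.
Proof. exact: (le_bigmax _ (fun j => l1norm (col j Z))). Qed.

Lemma max_l1norm_eq0 (R : realType) (n : nat) (Z : 'M[R]_n) :
  max_l1norm Z <= 0 -> Z = 0.
Proof.
move=> Z0; apply/matrixP => i j; rewrite mxE; apply/eqP; rewrite -normr_le0.
apply: le_trans (le_trans (l1norm_col_le_max Z j) Z0).
by rewrite /l1norm (bigD1 i)//= mxE lerDl sumr_ge0.
Qed.

(* [G - gaussian_residual] is a subgradient of the norm at [X], scaled by [t] in
   each maximal column and zero elsewhere. *)
Definition gaussian_residual (R : realType) (n : nat) (X : 'M[R]_n) (t : R)
    (i j : 'I_n) (g : R) : R :=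
  if j \notin max_l1_columns X then g
  else if X i j == 0 then soft_threshold t g
  else g - t * Num.sg (X i j).

Lemma measurable_gaussian_residual (R : realType) (n : nat) (X : 'M[R]_n)
    (t : R) (i j : 'I_n) :
  measurable_fun [set: R] (gaussian_residual X t i j).
Proof.
rewrite /gaussian_residual; case: (j \notin _) => //; case: (X i j == 0).
  exact: measurable_soft_threshold.
exact: measurable_funB.
Qed.

(** Off the support the clamped value is at most [t] in modulus; on it, [sg x * (x + y) <= |x + y|]
    while [sg x * x = |x|]. *)
Lemma gaussian_residual_subgradient (R : realType) (n : nat) (X : 'M[R]_n)
    (t g y : R) (i j : 'I_n) : 0 <= t -> j \in max_l1_columns X ->
  (g - gaussian_residual X t i j g) * y <= t * (`|X i j + y| - `|X i j|).
Proof.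
move=> t0 jX; rewrite /gaussian_residual jX/=; case: eqVneq => [->|Xij].
  rewrite add0r normr0 subr0 /soft_threshold opprB addrC subrK.
  set m := Num.max _ _.
  have mt : `|m| <= t.
    by rewrite ler_norml le_max lexx ge_max ge_min lexx/= andbT; lra.
  by rewrite (le_trans (ler_norm _))// normrM ler_wpM2r.
rewrite opprB addrC subrK -mulrA ler_wpM2l// lerBrDr.
rewrite (normrEsg (X i j)) -mulrDr addrC.
by rewrite (le_trans (ler_norm _))// normrM normr_sg Xij mul1r.
Qed.

Lemma descent_cone_inner_le (R : realType) (n : nat) (X V G : 'M[R]_n) (t : R) :
  0 <= t -> descent_cone (@max_l1norm R n) X V ->
  \sum_i \sum_j G i j * V i j <=
  \sum_i \sum_j gaussian_residual X t i j (G i j) * V i j.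
Proof.
move=> t0 [u [u0 XuV]]; rewrite exchange_big [leRHS]exchange_big/=.
apply: ler_sum => j _.
have [jX|jX] := boolP (j \in max_l1_columns X); last first.
  by apply: ler_sum => i _; rewrite /gaussian_residual jX.
rewrite -subr_le0 -sumrB -(pmulr_lle0 _ u0) mulr_suml.
apply: (@le_trans _ _ (\sum_i t * (`|X i j + u * V i j| - `|X i j|))).
  apply: ler_sum => i _; rewrite -mulrBl -mulrA [V i j * u]mulrC.
  exact: gaussian_residual_subgradient.
(* In a maximal column, the l1-norm after the step is at most the maximum for [X + u *: V], hence at
   most that for [X], which this column attains. *)
rewrite -mulr_sumr mulr_ge0_le0// sumrB subr_le0.
have -> : \sum_i `|X i j| = max_l1norm X.
  move: jX; rewrite inE => /eqP <-.
  by apply: eq_bigr => i _; rewrite mxE.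
apply: le_trans XuV; apply: le_trans (l1norm_col_le_max _ j).
by apply: ler_sum => i _; rewrite !mxE.
Qed.

(** A step of length [|X i j|] annihilates this entry and fixes all others, so no column norm
    grows. *)
Lemma zeroing_direction_descends (R : realType) (n : nat) (X : 'M[R]_n)
    (i j : 'I_n) : X i j != 0 ->
  descent_cone (@max_l1norm R n) X (- Num.sg (X i j) *: delta_mx i j).
Proof.
move=> Xij; exists `|X i j|; split; first by rewrite normr_gt0.
apply: le_bigmax2 => k _; apply: ler_sum => l _.
rewrite !mxE mulrA mulrN -[_ * Num.sg _]mulrC mulr_sg_norm.
case: eqVneq => [->|_]; case: eqVneq => [->|_] /=;
  by rewrite ?mulr1 ?mulr0 ?addr0 ?subrr ?normr0.
Qed.

Lemma frobenius_sgZ_delta (R : realType) (n : nat) (x : R) (i j : 'I_n) :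
  x != 0 -> frobenius (- Num.sg x *: delta_mx i j) = 1.
Proof.
move=> x0; rewrite /frobenius (bigD1 i)//= (bigD1 j)//= !big1.
- by rewrite !mxE !eqxx mulr1 sqrrN sqr_sg x0 !addr0 sqrtr1.
- move=> k ki; rewrite big1// => l _.
  by rewrite !mxE (negbTE ki) mulr0 expr0n.
- by move=> l lj; rewrite !mxE eqxx (negbTE lj) mulr0 expr0n.
Qed.

Lemma tr_delta (R : comNzRingType) (m n : nat) (A : 'M[R]_(m, n)) (a : R) i j :
  \tr (A^T *m (a *: delta_mx i j)) = a * A i j.
Proof.
rewrite mxtrace_trmxM (bigD1 i)//= (bigD1 j)//= !big1.
- by rewrite !mxE !eqxx mulr1 !addr0 mulrC.
- move=> k ki; rewrite big1// => l _.
  by rewrite !mxE (negbTE ki) !mulr0.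
- by move=> l lj; rewrite !mxE eqxx (negbTE lj) !mulr0.
Qed.

(** * Expected squared residual, summed by columns *)

Lemma integral_gaussian_residual_sqr (R : realType) (n : nat) (X : 'M[R]_n)
    (t : R) (i j : 'I_n) : 0 <= t -> 2 <= t ^+ 2 ->
  (\int[normal_prob 0 1]_x (gaussian_residual X t i j x ^+ 2)%:E <=
   (if j \in max_l1_columns X then
      (X i j != 0)%:R * (1 + t ^+ 2) + 2 * expR (- (t ^+ 2 / 2))
    else 1)%:E)%E.
Proof.
move=> t0 t2; rewrite /gaussian_residual.
case: ifPn => /= jX; last first.
  have := integral_normal_sqrB (0 : R); rewrite expr0n/= addr0.
  by under eq_integral do rewrite subr0.
have e0 := expR_ge0 (- (t ^+ 2 / 2)).
case: eqVneq => [_|Xij] /=.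
  by rewrite mul0r add0r integral_normal_soft_threshold.
apply: (le_trans (integral_normal_sqrB _)).
by rewrite lee_fin mul1r exprMn sqr_sg Xij mulr1; lra.
Qed.

Lemma sumr_natr_card (R : pzSemiRingType) (I : finType) (A : pred I) :
  \sum_i ((A i)%:R : R) = #|A|%:R.
Proof.
rewrite -sum1_card natr_sum [RHS]big_mkcond/=.
by apply: eq_bigr => i _; rewrite unfold_in; case: (A i).
Qed.

Lemma sum_residual_bound_le (R : realType) (n s : nat) (X : 'M[R]_n) (a e : R) :
  (forall j : 'I_n, sparse s (col j X)) -> 0 <= a ->
  \sum_i \sum_j (if j \in max_l1_columns X then (X i j != 0)%:R * a + e else 1)
  <= n%:R ^+ 2 - #|max_l1_columns X|%:R * (n%:R - (s%:R * a + n%:R * e)).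
Proof.
move=> sX a0; rewrite exchange_big/=.
(* Split by columns: a maximal one contributes at most [s * a + n * e], any other exactly [n]. *)
have -> : n%:R ^+ 2 - #|max_l1_columns X|%:R * (n%:R - (s%:R * a + n%:R * e)) =
    \sum_(j < n) (n%:R - (j \in max_l1_columns X)%:R *
                         (n%:R - (s%:R * a + n%:R * e))).
  rewrite big_split/= sumr_const card_ord sumrN -mulr_suml sumr_natr_card.
  by rewrite -[n%:R *+ n]mulr_natr -expr2; congr (_ - _).
apply: ler_sum => j _; case: (j \in _).
  rewrite big_split/= -mulr_suml !sumr_const card_ord mul1r.
  rewrite opprB [leRHS]addrC subrK -[e *+ n]mulr_natl lerD2r ler_wpM2r//.
  rewrite (_ : \sum_i _ = #|[pred i | col j X i 0 != 0]|%:R); last first.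
    by rewrite -sumr_natr_card; apply: eq_bigr => i _; rewrite /= mxE.
  by rewrite ler_nat; exact: sX.
by rewrite sumr_const card_ord mul0r subr0.
Qed.

(** * From the residual to the width *)

Lemma gaussian_width_descent0 (d : measure_display) (T : measurableType d)
    (R : realType) (P : probability T R) (n : nat)
    (G : 'I_n -> 'I_n -> {RV P >-> R}) :
  gaussian_width G (descent_cone (@max_l1norm R n) 0) = 0%E.
Proof.
have K0 : descent_cone (@max_l1norm R n) 0 `&` @frobenius_sphere R n = set0.
  rewrite -subset0 => U [[t [t0]]].
  have F0 : max_l1norm (0 : 'M[R]_n) <= 0.
    apply: bigmax_le => // j _.
    by rewrite /l1norm big1// => i _; rewrite !mxE normr0.
  rewrite add0r => /le_trans/(_ F0)/max_l1norm_eq0/eqP.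
  rewrite scaler_eq0 gt_eqF//= => /eqP ->.
  rewrite /frobenius_sphere/= /frobenius big1 ?sqrtr0 => [/eqP|i _].
    by rewrite eq_sym oner_eq0.
  by rewrite big1// => j _; rewrite mxE expr0n.
rewrite /gaussian_width K0 unlock.
by under eq_integral do rewrite image_set0 sup0; rewrite integral0.
Qed.

(* The width integrand is bounded above through [<D, U> <= (|D|^2 / b + b) / 2]
   with [b = sqrt B], which avoids integrating the norm of [D] itself, and below
   by testing against the direction that zeroes one entry of [X]. *)
Lemma sqr_gaussian_width_le (d : measure_display) (T : measurableType d)
    (R : realType) (P : probability T R) (n : nat)
    (G : 'I_n -> 'I_n -> {RV P >-> R}) (X : 'M[R]_n) (t B : R)
    (c : 'I_n -> 'I_n -> R) :
  iid_standard_gaussian G -> X != 0 -> 0 <= t ->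
  (forall i j, \int[normal_prob 0 1]_x (gaussian_residual X t i j x ^+ 2)%:E
    <= (c i j)%:E)%E ->
  \sum_i \sum_j c i j <= B -> 1 <= B ->
  (gaussian_width G (descent_cone (@max_l1norm R n) X) ^+ 2 <= B%:E)%E.
Proof.
move=> [_ GE] X0 t0 qc cB B1.
have [[i0 j0] /= Xij] : exists ij : 'I_n * 'I_n, X ij.1 ij.2 != 0.
  apply/existsP; apply: contra_neqT X0; rewrite negb_exists => /forallP X0.
  apply/matrixP => i j; rewrite mxE; apply/eqP.
  by have := X0 (i, j); rewrite negbK.
have B0 : 0 <= B by lra.
pose b := Num.sqrt B.
have bB : b ^+ 2 = B by rewrite sqr_sqrtr.
have b0 : 0 <= b by exact: sqrtr_ge0.
have b1 : 1 <= b by rewrite -(@sqrtr1 R) ler_wsqrtr.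
have bgt0 : 0 < b by lra.
pose S w := \sum_i \sum_j gaussian_residual X t i j (G i j w) ^+ 2.
have S0 w : 0 <= S w.
  by apply: sumr_ge0 => i _; apply: sumr_ge0 => j _; exact: sqr_ge0.
have mS : measurable_fun [set: T] S.
  apply: measurable_sum => i; apply: measurable_sum => j.
  apply: measurable_funX; apply: measurableT_comp => //.
  exact: measurable_gaussian_residual.
have upper w U : descent_cone (@max_l1norm R n) X U -> frobenius_sphere U ->
    \tr ((random_matrix G w)^T *m U) <= (S w / b + b) / 2.
  move=> KU U1; rewrite mxtrace_trmxM.
  rewrite (le_trans (descent_cone_inner_le _ t0 KU))//.
  have U2 : \sum_i \sum_j U i j ^+ 2 = 1 by rewrite -sqr_frobenius U1 expr1n.
  have -> : (S w / b + b) / 2 = \sum_i \sum_j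
      (gaussian_residual X t i j (G i j w) ^+ 2 / b + b * U i j ^+ 2) / 2.
    under eq_bigr do rewrite -mulr_suml big_split/= -mulr_suml -mulr_sumr.
    by rewrite -mulr_suml big_split/= -mulr_suml -mulr_sumr U2 mulr1.
  apply: ler_sum => i _; apply: ler_sum => j _; rewrite mxE.
  set q := gaussian_residual _ _ _ _ _; set u := U i j.
  rewrite -subr_ge0 (_ : _ - _ = (q - b * u) ^+ 2 / (2 * b)).
    by rewrite divr_ge0 ?sqr_ge0// mulr_ge0.
  by field; rewrite gt_eqF.
pose V : 'M[R]_n := - Num.sg (X i0 j0) *: delta_mx i0 j0.
have KV := zeroing_direction_descends Xij.
have V1 : frobenius_sphere V := frobenius_sgZ_delta i0 j0 Xij.
rewrite /gaussian_width unlock -bB.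
(* The second majorant bounds the negated supremum, as [sg x * g <= (g ^+ 2 + 1) / 2]; its mean is
   at most 1, hence at most [b]. *)
apply: (@sqr_integral_le_nonmeasurable _ _ _ _ _ (fun w => (S w / b + b) / 2)
  (fun w => (G i0 j0 w ^+ 2 / 1 + 1) / 2)).
- by move=> w; rewrite divr_ge0// addr_ge0// divr_ge0.
- by move=> w; rewrite divr_ge0// addr_ge0// divr_ge0// sqr_ge0.
- move=> w; apply: ge_sup.
    by exists (\tr ((random_matrix G w)^T *m V)); exists V.
  by move=> _ [U [KU U1] <-]; exact: upper.
- move=> w; rewrite lerNl.
  apply: (@le_trans _ _ (\tr ((random_matrix G w)^T *m V))); last first.
    apply: ub_le_sup; last by exists V.
    by exists ((S w / b + b) / 2) => _ [U [KU U1] <-]; exact: upper.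
  rewrite tr_delta mxE divr1.
  have := sqr_ge0 (Num.sg (X i0 j0) * G i0 j0 w - 1).
  rewrite sqrrB1 exprMn sqr_sg Xij mul1r mulr2n; lra.
- apply: le_trans (integral_halfD_le (c := B) _ _ _ _) _ => //.
    apply: (le_trans (integral_sum_standard_gaussian_le
      (q := fun i j x => gaussian_residual X t i j x ^+ 2) (c := c) GE _ _ qc)).
    - move=> i j; apply: measurable_funX.
      exact: measurable_gaussian_residual.
    - by move=> i j x; exact: sqr_ge0.
    - by rewrite lee_fin.
  rewrite lee_fin -{1}bB expr2 mulfK ?gt_eqF//; lra.
- apply: le_trans (integral_halfD_le (c := 1) _ _ _ _) _ => //.
  + exact: measurable_funX.
  + by move=> w; exact: sqr_ge0.
  + rewrite (integral_standard_gaussian (q := fun x => x ^+ 2) (GE i0 j0)).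
    * have := integral_normal_sqrB (0 : R); rewrite expr0n/= addr0.
      by under eq_integral do rewrite subr0.
    * exact: measurable_funX.
    * by move=> x; exact: sqr_ge0.
  + by rewrite lee_fin; lra.
Qed.

(** * Choice of the threshold and conclusion *)

Lemma threshold_bound (R : realType) (n s r : nat) :
  (0 < n)%N ->
  let t2 : R := 2 * (1 + ln (n%:R * r%:R)) in
  2 <= t2 /\
  r%:R * (s%:R * (1 + t2) + n%:R * (2 * expR (- (t2 / 2)))) <=
  1 + r%:R * (s%:R * ln (expR 3 * n%:R ^+ 4 * r%:R ^+ 2)).
Proof.
(* For [r = 0] the convention [ln 0 = 0] gives [t2 = 2]. *)
move=> n0 t2; have [r0|r0] := posnP r.
  by rewrite /t2 r0 mulr0 ln0// !mul0r; lra.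
have nR : 1 <= n%:R :> R by rewrite ler1n.
have rR : 1 <= r%:R :> R by rewrite ler1n.
have n_gt0 : 0 < n%:R :> R by lra.
have r_gt0 : 0 < r%:R :> R by lra.
have lnn : 0 <= ln n%:R :> R by exact: ln_ge0.
have lnr : 0 <= ln r%:R :> R by exact: ln_ge0.
have lnnr : ln (n%:R * r%:R) = ln n%:R + ln r%:R :> R by rewrite lnM.
split; first by rewrite /t2 lnnr; lra.
have -> : ln (expR 3 * n%:R ^+ 4 * r%:R ^+ 2) =
    3 + 4 * ln n%:R + 2 * ln r%:R :> R.
  rewrite !lnM ?posrE ?mulr_gt0 ?expR_gt0//.
  by rewrite expRK; lra.
(* The product is [expR (-1)]; doubled, it is absorbed by the summand 1 of the final bound. *)
have e : n%:R * r%:R * expR (- (t2 / 2)) <= 2^-1.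
  have -> : t2 / 2 = 1 + ln (n%:R * r%:R) by rewrite /t2; field.
  rewrite opprD expRD !expRN lnK ?posrE ?mulr_gt0//.
  rewrite mulrCA divff ?gt_eqF ?mulr_gt0// mulr1 lef_pV2 ?posrE ?expR_gt0//.
  by have := expR_ge1Dx (1 : R); lra.
have s0 : 0 <= s%:R :> R by [].
have : r%:R * (s%:R * (1 + t2)) <=
    r%:R * (s%:R * (3 + 4 * ln n%:R + 2 * ln r%:R)).
  rewrite ler_wpM2l// ?ler_wpM2l// /t2 lnnr; lra.
lra.
Qed.

Theorem lemma5p1 (R : realType) :
  exists C : R, 0 < C /\
    forall (n s : nat) (X : 'M[R]_n),
      (0 < n)%N ->
      (forall j : 'I_n, sparse s (col j X)) ->
      forall (d : measure_display) (T : measurableType d) (P : probability T R)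
        (G : 'I_n -> 'I_n -> {RV P >-> R}),
        iid_standard_gaussian G ->
        let r := #|max_l1_columns X| in
        let w := gaussian_width G (descent_cone (@max_l1norm R n) X) in
        (w ^+ 2 <= (1 + n%:R ^+ 2
             - r%:R * (n%:R - s%:R * ln (C * n%:R ^+ 4 * r%:R ^+ 2)))%:E)%E
        /\ (r = n ->
            (w ^+ 2 <= (1 + n%:R * s%:R * ln (C * n%:R ^+ 6))%:E)%E).
Proof.
exists (expR 3); split; first exact: expR_gt0.
move=> n s X n0 sX d T P G iidG r w.
set L := ln _; set B : R := _ - r%:R * _.
suff wB : (w ^+ 2 <= B%:E)%E.
  split=> // rn; apply: le_trans wB _; rewrite lee_fin /B /L rn.
  by rewrite -mulrA -exprD; lra.
have rn : (r <= n)%N by rewrite -[leqRHS]card_ord max_card.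
have rnR : r%:R * n%:R <= n%:R ^+ 2 :> R.
  by rewrite expr2 ler_wpM2r// ler_nat.
have L0 : 0 <= r%:R * (s%:R * L).
  (* For [r = 0] the logarithm is taken at 0, but the factor [r] removes it. *)
  have [->|r0] := posnP r; first by rewrite mul0r.
  rewrite !mulr_ge0// ln_ge0//.
  have e3 : 1 <= expR 3 :> R by rewrite ltW// expR_gt1.
  by apply: mulr_ege1 (mulr_ege1 e3 _) _; rewrite exprn_ege1// ler1n.
have B1 : 1 <= B by rewrite /B; lra.
have [X0|X0] := eqVneq X 0.
  rewrite /w X0 gaussian_width_descent0 -EFin_expe lee_fin expr0n/=; lra.
have [t2 tB] := threshold_bound R s r n0.
set u := 2 * (1 + ln _) in t2 tB.
have tE : Num.sqrt u ^+ 2 = u by rewrite sqr_sqrtr; lra.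
apply: (sqr_gaussian_width_le iidG X0 (sqrtr_ge0 u)
  (fun i j => integral_gaussian_residual_sqr X i j _ _)) => //.
  by rewrite tE.
rewrite tE; apply: (le_trans (sum_residual_bound_le _ sX _)); first by lra.
by rewrite -/r /B /L; lra.
Qed.
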